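(* Let $G$ be a group and let $\mathrm{ZR}_*(G)$ denote either $\mathrm{ZR}_l(G)$ or $\mathrm{ZR}(G)$, equipped with the refinement order $\boldsymbol{\leq}$. Then $\mathrm{ZR}_*(G)$ is a join-semilattice in the following sense: it is a partially ordered set in which every non-empty subset has an infimum. Moreover, for every $\preceq\in\mathrm{ZR}_*(G)$, the set $\mathrm{Raf}^-_*(\preceq)=\{\preceq'\in\mathrm{ZR}_*(G)\mid \preceq'\,\boldsymbol{\leq}\,\preceq\}$ is totally ordered by $\boldsymbol{\leq}$.
   Context: A left-invariant preorder on a group $G$ is a binary relation $\preceq$ on $G$ that is total ($u\preceq v$ or $v\preceq u$ for all $u,v\in G$), transitive, and such that $u\preceq v$ implies $wu\preceq wv$ for all $u,v,w\in G$. It is bi-invariant if in addition $u\preceq v$ implies $uw\preceq vw$. $\mathrm{ZR}_l(G)$ is the set of left-invariant preorders on $G$ and $\mathrm{ZR}(G)$ the set of bi-invariant ones. For $\preceq_1,\preceq_2\in\mathrm{ZR}_*(G)$, one writes $\preceq_1\,\boldsymbol{\leq}\,\preceq_2$ (and says that $\preceq_2$ refines $\preceq_1$) if for all $u,v\in G$, $u\preceq_2 v$ implies $u\preceq_1 v$. *)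

(* Defs.v *)
From mathcomp Require Import all_boot.
From mathcomp Require Import boolp classical_sets.

Set Implicit Arguments.
Unset Strict Implicit.
Unset Printing Implicit Defensive.

Local Open Scope classical_set_scope.
Local Open Scope group_scope.

(* [groupType] bundles a [choiceType] structure; classically every type carries
   one ([boolp.gen_choiceMixin]), so [G] ranges over arbitrary groups, finite
   or not. *)
Section Preorders.
Variable G : groupType.
Implicit Types (r : G -> G -> Prop) (Z : set (G -> G -> Prop)).

Definition left_invariant_preorder r : Prop :=
  [/\ total_on [set: G] r,
      forall u v w, r u v -> r v w -> r u w
    & forall u v w, r u v -> r (w * u) (w * v)].

Definition bi_invariant_preorder r : Prop :=
  left_invariant_preorder r /\ forall u v w, r u v -> r (u * w) (v * w).

Definition ZRl : set (G -> G -> Prop) := [set r | left_invariant_preorder r].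

Definition ZR : set (G -> G -> Prop) := [set r | bi_invariant_preorder r].

(* [refine_le r1 r2] holds when [r2] refines [r1]: the finer preorder is the
   larger one, i.e. the order is reverse inclusion of graphs. *)
Definition refine_le r1 r2 : Prop := forall u v, r2 u v -> r1 u v.

Definition Raf_minus Z r : set (G -> G -> Prop) :=
  [set r' | Z r' /\ refine_le r' r].

End Preorders.

Arguments ZRl : clear implicits.
Arguments ZR : clear implicits.

Section OrderOnSet.
Variables (T : Type) (Z : set T) (le : T -> T -> Prop).

Definition partial_order_on : Prop :=
  [/\ forall x, Z x -> le x x,
      forall x y, Z x -> Z y -> le x y -> le y x -> x = y
    & forall x y z, Z x -> Z y -> Z z -> le x y -> le y z -> le x z].

Definition is_lower_bound_in (S : set T) (m : T) : Prop :=
  Z m /\ forall x, S x -> le m x.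

Definition is_infimum_in (S : set T) (m : T) : Prop :=
  is_lower_bound_in S m /\ forall m', is_lower_bound_in S m' -> le m' m.

End OrderOnSet.

(* Main.v *)
Require Import Defs.
From mathcomp Require Import all_boot.
From mathcomp Require Import boolp classical_sets.

(** Inclusion of graphs being reversed, an infimum of a family [S] is a least
    invariant preorder containing every member of [S]. Transitivity and
    invariance pass to intersections, and totality passes to any larger
    relation; so the intersection of all lower bounds of [S] is again an
    invariant preorder as soon as [S] has one member to make it total
    ([inter_lower_bounds_left_invariant]).

    For the chain condition, a left-invariant relation [r] is determined by its
    positive cone, the set of [g] with [r 1 g], since [r u v] is equivalent to
    [r 1 (u^-1 * v)]. If [r'] coarsens [r], its cone is an up-set for [r]; as
    [r] is total, its up-sets form a chain under inclusion, hence so do its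
    coarsenings ([Raf_minus_ZRl_total]). Since every
    bi-invariant preorder is left-invariant, this settles both cases. *)

Local Open Scope classical_set_scope.
Local Open Scope group_scope.

Lemma refine_le_partial_order (G : groupType) (Z : set (G -> G -> Prop)) :
  partial_order_on Z (@refine_le G).
Proof.
split=> [r _ u v //|r1 r2 _ _ le12 le21|r1 r2 r3 _ _ _ le12 le23 u v].
  by apply/funext=> u; apply/funext=> v; apply/propext; split=> [/le21|/le12].
by move=> /le23 /le12.
Qed.

Definition inter_lower_bounds (G : groupType) (Z S : set (G -> G -> Prop)) :
    G -> G -> Prop :=
  fun u v => forall r, is_lower_bound_in Z (@refine_le G) S r -> r u v.

(** The intersection is a lower bound because every member of [S] is
    contained in every lower bound, hence in their intersection. *)
Lemma inter_lower_bounds_infimum (G : groupType) (Z S : set (G -> G -> Prop)) :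
  Z (inter_lower_bounds G Z S) ->
  is_infimum_in Z (@refine_le G) S (inter_lower_bounds G Z S).
Proof.
move=> Zm; split; first split=> // s Ss u v suv r [_ ler].
  exact: ler suv.
by move=> r lbr u v; apply.
Qed.

Lemma inter_lower_bounds_left_invariant (G : groupType)
    (Z S : set (G -> G -> Prop)) :
  Z `<=` ZRl G -> S `<=` Z -> S !=set0 ->
  left_invariant_preorder (inter_lower_bounds G Z S).
Proof.
move=> ZL SZ [s Ss]; have [s_total _ _] := ZL _ (SZ _ Ss).
split=> [u v _ _|u v w muv mvw r lbr|u v w muv r lbr].
- by case: (s_total u v I I) => suv; [left|right] => r [_ /(_ s Ss)]; apply.
- have [_ rT _] := ZL _ lbr.1.
  by apply: rT (muv r lbr) (mvw r lbr).
- have [_ _ rM] := ZL _ lbr.1.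
  exact: rM (muv r lbr).
Qed.

Lemma ZRl_infimum (G : groupType) (S : set (G -> G -> Prop)) :
  S `<=` ZRl G -> S !=set0 ->
  exists m, is_infimum_in (ZRl G) (@refine_le G) S m.
Proof.
move=> SZ S0; exists (inter_lower_bounds G (ZRl G) S).
by apply: inter_lower_bounds_infimum; apply: inter_lower_bounds_left_invariant.
Qed.

Lemma ZR_infimum (G : groupType) (S : set (G -> G -> Prop)) :
  S `<=` ZR G -> S !=set0 ->
  exists m, is_infimum_in (ZR G) (@refine_le G) S m.
Proof.
move=> SZ S0; exists (inter_lower_bounds G (ZR G) S).
apply: inter_lower_bounds_infimum; split.
  by apply: inter_lower_bounds_left_invariant => // r [].
by move=> u v w muv r lbr; apply: lbr.1.2 (muv r lbr).
Qed.

Lemma left_invariant_cone (G : groupType) (r : G -> G -> Prop) (u v : G) :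
  left_invariant_preorder r -> r u v <-> r 1 (u^-1 * v).
Proof.
case=> _ _ rM; split=> [/(rM _ _ u^-1)|/(rM _ _ u)]; first by rewrite mulVg.
by rewrite mulg1 mulgA mulgV mul1g.
Qed.

(** Elements [g] and [h] witnessing that neither cone contains the other would
    be incomparable for [r]: if [r g h], then [h] lies in every up-set
    containing [g], and symmetrically. *)
Lemma Raf_minus_ZRl_total (G : groupType) (r : G -> G -> Prop) :
  ZRl G r -> total_on (Raf_minus (ZRl G) r) (@refine_le G).
Proof.
case=> r_total _ _ r1 r2 [L1 le1] [L2 le2].
have [_ T1 _] := L1; have [_ T2 _] := L2.
apply: contrapT => /not_orP[nle12 nle21]; apply: nle12 => u v.
move=> /(left_invariant_cone _ _ _ _ L2) r2g.
apply/(left_invariant_cone _ _ _ _ L1); apply: contrapT => nr1g.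
apply: nle21 => x y /(left_invariant_cone _ _ _ _ L1) r1h.
apply/(left_invariant_cone _ _ _ _ L2).
have [/le2 r2gh|/le1 r1hg] := r_total (u^-1 * v) (x^-1 * y) I I.
  exact: T2 r2g r2gh.
by case: nr1g; apply: T1 r1h r1hg.
Qed.

Local Close Scope group_scope.

Theorem theorem2p19 (G : groupType) (Z : set (G -> G -> Prop))
    (hZ : Z = ZRl G \/ Z = ZR G) :
  [/\ partial_order_on Z (@refine_le G),
      forall S : set (G -> G -> Prop), S `<=` Z -> S !=set0 ->
        exists m, is_infimum_in Z (@refine_le G) S m
    & forall r, Z r -> total_on (Raf_minus Z r) (@refine_le G)].
Proof.
split; first exact: refine_le_partial_order.
  by case: hZ => ->; [exact: ZRl_infimum|exact: ZR_infimum].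
have ZL : Z `<=` ZRl G by case: hZ => -> // r [].
move=> r /ZL Lr r1 r2 [/ZL L1 le1] [/ZL L2 le2].
exact: Raf_minus_ZRl_total Lr _ _ (conj L1 le1) (conj L2 le2).
Qed.
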